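(* There exists an absolute constant $C>0$ such that for all $x\ge 3$ $$\sup\, T(S,x)\ \ge\ C\,x^{-2},\qquad S=\frac{1}{\sqrt{A}}\sum_{i=1}^{\eta}\xi(i),$$ where $\xi(1),\xi(2),\ldots$ are i.i.d. random variables with the standard normal distribution $N(0,1)$, and the supremum is taken over all $A\in[2,\infty)$ and over all laws of random variables $\eta$ with values in $\{1,2,\ldots\}$, independent of $\{\xi(i)\}$, with $\mathbf{E}\eta=A$.
   Context: For a random variable $\tau$ and $x\ge 0$, $T(\tau,x)=\max\left(\mathbf{P}(\tau\ge x),\mathbf{P}(\tau\le -x)\right)$. *)

(* Defs.v *)
From HB Require Import structures.
From mathcomp Require Import all_boot all_order all_algebra.
From mathcomp Require Import all_classical all_reals all_analysis.
From mathcomp Require Import measurable_realfun.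

Set Implicit Arguments.
Unset Strict Implicit.
Unset Printing Implicit Defensive.
Import Order.TTheory GRing.Theory Num.Theory.
Import numFieldNormedType.Exports.

Local Open Scope classical_set_scope.
Local Open Scope ring_scope.

(* T(tau, x) *)
Definition two_sided_tail d (T : measurableType d) (R : realType)
    (P : probability T R) (tau : {RV P >-> R}) (x : R) : \bar R :=
  maxe (P [set w | x <= tau w]) (P [set w | tau w <= - x]).
Arguments two_sided_tail {d T R} P tau x.

Definition mutually_independent d (T : measurableType d) (R : realType)
    (P : probability T R) (xi : nat -> {RV P >-> R}) : Prop :=
  forall (s : seq nat) (B : nat -> set R),
    uniq s -> (forall i, i \in s -> measurable (B i)) ->
    P (\bigcap_(i in [set` s]) (xi i @^-1` B i)) =
    (\prod_(i <- s) P (xi i @^-1` B i))%E.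
Arguments mutually_independent {d T R} P xi.

Definition sigma_of_sequence d (T : measurableType d) (R : realType)
    (P : probability T R) (xi : nat -> {RV P >-> R}) : set (set T) :=
  <<s \bigcup_i preimage_set_system [set: T] (xi i) measurable >>.
Arguments sigma_of_sequence {d T R} P xi _.

(* As nat carries the discrete sigma-algebra, the events eta @^-1` B below
   exhaust the sigma-algebra generated by eta. *)
Definition independent_of_sequence d (T : measurableType d) (R : realType)
    (P : probability T R) (eta : {RV P >-> nat}) (xi : nat -> {RV P >-> R})
    : Prop :=
  forall (B : set nat) (E : set T), sigma_of_sequence P xi E ->
    P (eta @^-1` B `&` E) = (P (eta @^-1` B) * P E)%E.
Arguments independent_of_sequence {d T R} P eta xi.

Definition iid_standard_normal d (T : measurableType d) (R : realType)
    (P : probability T R) (xi : nat -> {RV P >-> R}) : Prop :=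
  mutually_independent P xi /\
  forall (i : nat) (B : set R), measurable B ->
    distribution P (xi i) B = normal_prob 0 1 B.
Arguments iid_standard_normal {d T R} P xi.

(* The sequence is indexed from 0: xi i stands for the (i+1)-st variable, so
   the sum has exactly eta w terms. *)
Definition random_sum d (T : measurableType d) (R : realType)
    (P : probability T R) (A : R) (xi : nat -> {RV P >-> R})
    (eta : {RV P >-> nat}) (w : T) : R :=
  (Num.sqrt A)^-1 * \sum_(i < eta w) xi i w.
Arguments random_sum {d T R} P A xi eta w.

Section random_sum_RV.
Context d (T : measurableType d) (R : realType) (P : probability T R) (A : R).
Variables (xi : nat -> {RV P >-> R}) (eta : {RV P >-> nat}).

Lemma measurable_random_sum : measurable_fun [set: T] (random_sum P A xi eta).
Proof.
apply: measurable_funM => //.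
move=> _ B mB; rewrite setTI.
have -> : (fun w => \sum_(i < eta w) xi i w) @^-1` B =
    \bigcup_n ((eta @^-1` [set n]) `&`
               ((fun w => \sum_(i < n) xi i w) @^-1` B)).
  apply/seteqP; split => [w Bw|w [n _ [/= <-]]] //.
  by exists (eta w).
apply: bigcup_measurable => n _; apply: measurableI.
  by rewrite -[X in measurable X]setTI; exact: measurable_funPT.
rewrite -[X in measurable X]setTI.
have mS : measurable_fun [set: T] (fun w => \sum_(i < n) xi i w).
  by apply: measurable_sum => i; exact: measurable_funPT.
exact: mS.
Qed.

HB.instance Definition _ :=
  isMeasurableFun.Build _ _ _ _ (random_sum P A xi eta) measurable_random_sum.

End random_sum_RV.

(* The values T(S, x) over all A in [2, +oo[ and all laws of eta; a law of eta
   is represented by a realization of (xi, eta) on some probability space, on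
   which the value T(S, x) does not otherwise depend. *)
Definition tail_values (R : realType) (x : R) : set (\bar R) :=
  [set t | exists (A : R) (d : measure_display) (T : measurableType d)
     (P : probability T R) (xi : nat -> {RV P >-> R}) (eta : {RV P >-> nat}),
     [/\ 2 <= A,
         iid_standard_normal P xi,
         forall w, (1 <= eta w)%N,
         independent_of_sequence P eta xi &
         ('E_P[fun w => (eta w)%:R : R] = A%:E)%E /\
         t = two_sided_tail P (random_sum P A xi eta) x]].

(* Main.v *)
(* Take A = 2 and let eta be 1 or N, the latter with probability 1/(N - 1),
   where N is about 2 x^2. Given eta = N, the sum S is normal with variance
   N/2, at least x^2, so it exceeds x with probability bounded below, whence
   a tail of order 1/(N - 1), that is x^-2.

   The i.i.d. sequence lives on [0, 1]. Separating the binary digits of even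
   and odd rank sends a uniform u to two independent uniforms; the first one
   yields a normal variable h u through the quantile function, the second one,
   V u, is split again, and the variables h (V^i u) are i.i.d. normal. *)

Require Import Defs.
From HB Require Import structures.
From mathcomp Require Import all_boot all_order all_algebra.
From mathcomp Require Import all_classical all_reals all_analysis.
From mathcomp Require Import measurable_realfun ring lra.
Import Order.TTheory GRing.Theory Num.Theory.
Import numFieldNormedType.Exports.
Local Open Scope classical_set_scope.
Local Open Scope ring_scope.

Set Implicit Arguments.
Unset Strict Implicit.
Unset Printing Implicit Defensive.

(** * Laws on the real line *)

(** The tail values range over realizations, so a probability space carrying both a whole i.i.d.
    normal sequence and an independent [eta] has to be exhibited. The shift is therefore applied
    once before the sequence starts: the variables used are h (V^(i+1) u), all functions of V u, and
    the first uniform [digits u] is left to decide [eta]. Independence of the two uniforms is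
    obtained without any counting of digits: their joint distribution function and the product of
    the marginals obey the same self-similarity relation, which is contracting. Every passage from
    distribution functions to laws goes through rays []-oo, x]]. The weight 1/(N - 1) is forced by
    the mean, since 1 + (N - 1) p = 2. *)

Lemma measure_eq_rays (R : realType)
    (m1 m2 : {measure set (measurableTypeR R) -> \bar R}) :
  (m1 setT < +oo)%E ->
  (forall x : R, m1 `]-oo, x]%classic = m2 `]-oo, x]%classic) ->
  forall A, measurable A -> m1 A = m2 A.
Proof.
move=> m1fin m12.
pose G : set (set (measurableTypeR R)) := [set A | exists x, A = `]-oo, x]%classic].
have mG A : G A -> measurable (A : set (measurableTypeR R)).
  by move=> [x ->]; exact: measurable_itv.
apply: (@measure_unique _ R _ G (fun n => `]-oo, n%:R]%classic)).
- apply/seteqP; split => A; last first.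
    apply: smallest_sub; first exact: smallest_sigma_algebra.
    exact: mG.
  apply: smallest_sub; first exact: smallest_sigma_algebra.
  (* Half-open intervals generate the Borel sets, and each one is a difference of two rays. *)
  move=> _ [[a b] _ <-].
  have -> : `]a, b]%classic = `]-oo, b] `\` `]-oo, a].
    by rewrite -[RHS]setCK setCD setCitvl setUC -[LHS]setCK setCitv.
  have GR x : <<s G >> `]-oo, x]%classic.
    by apply: sub_sigma_algebra; exists x.
  have := @measurableD _ (g_sigma_algebraType G) _ _ (GR b) (GR a).
  by [].
- move=> _ _ [x ->] [y ->]; exists (Num.min x y).
  by apply/seteqP; split => z /=; rewrite !in_itv/= le_min => /andP.
- by move=> n; exists n%:R.
- apply/seteqP; split=> // x _; exists (Num.truncn x).+1 => //=.
  by rewrite in_itv/= ltW// truncnS_gt.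
- by move=> _ [x ->]; exact: m12.
- move=> n; apply: le_lt_trans m1fin; apply: le_measure; rewrite ?inE//.
Qed.

(* Stated with a factor [k] so that a law restricted to an event [D] of
   probability [k] can be identified. *)
Lemma restricted_law_eq (R : realType) d (T : measurableType d) (P : probability T R)
    (X : T -> measurableTypeR R) (D : set T) (Q : probability (measurableTypeR R) R) (k : R) :
  measurable_fun setT X -> measurable D -> 0 <= k ->
  (forall x : R, P (X @^-1` `]-oo, x] `&` D) = (k%:E * Q `]-oo, x]%classic)%E) ->
  forall B, measurable B -> P (X @^-1` B `&` D) = (k%:E * Q B)%E.
Proof.
move=> mX mD k0 ray B mB.
pose push : {measure set (measurableTypeR R) -> \bar R} :=
  pushforward (mrestr P mD) X.
pose m2 : {measure set (measurableTypeR R) -> \bar R} := mscale (NngNum k0) Q.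
suff : push mX B = m2 B by [].
apply: (@measure_eq_rays _ (push mX) m2) => //.
apply: le_lt_trans (ltry 1); apply: probability_le1 => /=.
by apply: measurableI => //; exact: measurableT.
Qed.

(** * Normal laws *)

(** Change of variables holds for the Radon-Nikodym derivative. It agrees almost everywhere with
    [normal_pdf], because both have the same integral over every measurable set. *)
Lemma integral_normal_prob (R : realType) (m s : R) (f : R -> \bar R) :
  measurable_fun setT f -> (forall x, 0 <= f x)%E ->
  (\int[normal_prob m s]_x f x =
   \int[lebesgue_measure]_x (f x * (normal_pdf m s x)%:E))%E.
Proof.
move=> mf f0.
have dom := @normal_prob_dominates R m s.
rewrite -(Radon_Nikodym_SigmaFinite.change_of_variables dom)//.
have mg : measurable_fun setT (Radon_Nikodym_SigmaFinite.f
    (normal_prob m s) (@lebesgue_measure R)).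
  exact/measurable_int/Radon_Nikodym_SigmaFinite.f_integrable.
have mpdf : measurable_fun [set: measurableTypeR R]
    (fun x => (normal_pdf m s x)%:E).
  by apply/measurable_EFinP; apply: measurable_normal_pdf.
apply: ae_eq_integral => //; [exact: emeasurable_funM..|].
apply: ae_eqe_mul2l.
apply: integral_ae_eq => //.
  exact: Radon_Nikodym_SigmaFinite.f_integrable.
move=> E _ mE.
by rewrite -Radon_Nikodym_SigmaFinite.f_integral.
Qed.

Lemma lebesgue_measure_translation (R : realType) (c : R)
    (A : set (measurableTypeR R)) : measurable A ->
  lebesgue_measure ((fun x => x + c) @^-1` A) = lebesgue_measure A.
Proof.
move=> mA.
have mc : measurable_fun [set: measurableTypeR R]
    (fun x : measurableTypeR R => (x + c : measurableTypeR R)).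
  by apply: measurable_funD => //; exact: measurable_id.
pose f : {mfun measurableTypeR R >-> measurableTypeR R} :=
  HB.pack (fun x : measurableTypeR R => (x + c : measurableTypeR R))
    (isMeasurableFun.Build _ _ _ _ _ mc).
rewrite -[LHS]/(pushforward lebesgue_measure f A).
apply/esym/lebesgue_measure_unique => //= _ [[a b]] _ <-.
rewrite /pushforward /=.
have -> : (fun x => x + c) @^-1` `]a, b]%classic = `]a - c, b - c]%classic.
  by apply/seteqP; split=> x /=; rewrite !in_itv/= ltrBlDr lerBrDr.
rewrite !lebesgue_measure_itv/= !lte_fin ltrD2r; case: ifP => // _.
by rewrite -!EFinB; congr EFin; ring.
Qed.

Lemma integral_translation (R : realType) (c : R) (f : R -> \bar R) :
  measurable_fun setT f -> (forall x, 0 <= f x)%E ->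
  (\int[lebesgue_measure]_x f (x + c)%R = \int[lebesgue_measure]_x f x)%E.
Proof.
move=> mf f0.
have mc : measurable_fun [set: measurableTypeR R]
    (fun x : measurableTypeR R => (x + c : measurableTypeR R)).
  by apply: measurable_funD => //; exact: measurable_id.
have := @ge0_integral_pushforward _ _ _ _ _ _ mc lebesgue_measure setT f
  measurableT mf (fun x _ => f0 x).
rewrite preimage_setT => <-.
by apply: eq_measure_integral => A mA _; exact: lebesgue_measure_translation.
Qed.

(** Completing the square in [x]. The last factor is the conditional density of the first variable
    given that the sum is [z], so integrating over [x] leaves the density of the sum. *)
Lemma normal_pdf_mul (R : realType) (s t x z : R) : 0 < s -> 0 < t ->
  let r := Num.sqrt (s ^+ 2 + t ^+ 2) in
  normal_pdf 0 s x * normal_pdf 0 t (z - x) =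
  normal_pdf 0 r z * normal_pdf (z * s ^+ 2 / r ^+ 2) (s * t / r) x.
Proof.
move=> s0 t0 r.
have st0 : 0 < s ^+ 2 + t ^+ 2 by rewrite addr_gt0// exprn_gt0.
have r0 : 0 < r by rewrite sqrtr_gt0.
have rE : r ^+ 2 = s ^+ 2 + t ^+ 2 by rewrite sqr_sqrtr// ltW.
have sn0 := lt0r_neq0 s0; have tn0 := lt0r_neq0 t0; have rn0 := lt0r_neq0 r0.
rewrite !normal_pdfE// ?mulf_neq0 ?invr_neq0//.
rewrite mulrACA [RHS]mulrACA; congr (_ * _).
  rewrite /normal_peak -!invfM -!sqrtrM ?mulrn_wge0 ?mulr_ge0 ?sqr_ge0 ?pi_ge0 ?invr_ge0 ?ltW//.
  by congr (Num.sqrt _)^-1; field; rewrite ?mulf_neq0.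
rewrite /normal_fun -!expRD; congr expR.
rewrite !exprMn exprVn rE; field.
by rewrite sn0 tn0 -[_ + _ == 0]/(s ^+ 2 + t ^+ 2 == 0) gt_eqF.
Qed.

Lemma normal_convolution (R : realType) (s t : R) (B : set (measurableTypeR R)) :
  0 < s -> 0 < t -> measurable B ->
  ((normal_prob 0 s \x normal_prob 0 t) [set z | B (z.1 + z.2)%R] =
   normal_prob 0 (Num.sqrt (s ^+ 2 + t ^+ 2)) B)%E.
Proof.
move=> s0 t0 mB; set r := Num.sqrt _.
have mpdf (m v : R) : measurable_fun [set: measurableTypeR R] (normal_pdf m v).
  exact: measurable_normal_pdf.
have m1B : measurable_fun [set: measurableTypeR R] (\1_B : _ -> R).
  exact: measurable_indic.
have pdf0 (m v x : R) := normal_pdf_ge0 m v x.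
have ind0 x : 0 <= \1_B x :> R by [].
have mF : measurable_fun [set: measurableTypeR R * measurableTypeR R]
    (fun z : measurableTypeR R * measurableTypeR R =>
      (\1_B z.2 * (normal_pdf 0 s z.1 * normal_pdf 0 t (z.2 - z.1)))%:E).
  apply/measurable_EFinP; apply: measurable_funM.
    exact: (measurableT_comp m1B).
  apply: measurable_funM; first exact: (measurableT_comp (mpdf 0 s)).
  apply: (measurableT_comp (mpdf 0 t)).
  by apply: measurable_funB.
(* The inner variable is the sum z = x + y instead of y, so that [B] constrains [z] alone and the
   integral over [x] can be done first after exchanging the order. *)
transitivity (\int[lebesgue_measure]_x \int[lebesgue_measure]_z
    (\1_B z * (normal_pdf 0 s x * normal_pdf 0 t (z - x)))%:E)%E.
  have mX : measurable [set z : measurableTypeR R * measurableTypeR R | B (z.1 + z.2)%R].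
    rewrite -[X in measurable X]setTI.
    have : measurable_fun setT
      (fun z : measurableTypeR R * measurableTypeR R => (z.1 + z.2 : measurableTypeR R)).
      by apply: measurable_funD.
    by move=> h; apply: h.
  rewrite /product_measure1 integral_normal_prob//; last first.
    exact: measurable_fun_xsection.
  apply: eq_integral => x _ /=.
  rewrite /normal_prob integral_mkcond.
  pose f z := (\1_B z * normal_pdf 0 t (z - x))%:E.
  have mf : measurable_fun [set: measurableTypeR R] f.
    apply/measurable_EFinP; apply: measurable_funM => //.
    by apply: (measurableT_comp (mpdf 0 t)); apply: measurable_funB.
  have f0 z : (0 <= f z)%E by rewrite lee_fin mulr_ge0.
  under [RHS]eq_integral do rewrite mulrCA EFinM.
  rewrite [RHS]ge0_integralZl//; last 2 first.
  - by move=> z _; exact: f0.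
  - by rewrite lee_fin.
  rewrite muleC; congr (_ * _)%E.
  rewrite -(integral_translation x mf f0).
  apply: eq_integral => y _.
  rewrite patchE /f addrK indicE mem_xsection.
  have -> : ((x, y) \in [set z | B (z.1 + z.2)]) = (y + x \in B).
    by apply/idP/idP; rewrite !inE /= addrC.
  by case: ifP => _; rewrite ?mul1r ?mul0r.
rewrite (@fubini_tonelli _ _ _ _ _ lebesgue_measure lebesgue_measure _ mF)/=; last first.
  by move=> z; rewrite lee_fin !mulr_ge0.
rewrite /normal_prob [RHS]integral_mkcond.
apply: eq_integral => z _.
under eq_integral do rewrite normal_pdf_mul// mulrA EFinM.
rewrite ge0_integralZl//=.
- by rewrite integral_normal_pdf mule1 patchE indicE; case: (z \in B) => //=;
    rewrite ?mul1r ?mul0r.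
- by apply/measurable_EFinP; apply: mpdf.
- by move=> x _; rewrite lee_fin.
- by rewrite lee_fin mulr_ge0.
Qed.

(** On [[s, 2 * s]] the density is at least its value at [2 * s]; multiplied by the length [s], this
    value is the standard density at 2, whatever the scale. *)
Lemma normal_prob_tail_ge (R : realType) (s : R) : 0 < s ->
  ((normal_pdf 0 1 2%:R)%:E <= normal_prob 0 s `[s, +oo[%classic)%E.
Proof.
move=> s0; have sn0 := lt0r_neq0 s0.
have sub : `[s, 2 * s] `<=` `[s, +oo[.
  by move=> x /=; rewrite !in_itv/= andbT => /andP[].
apply: (@le_trans _ _ (normal_prob 0 s `[s, 2 * s]%classic)); last first.
  by apply: le_measure => //; rewrite inE; exact: measurable_itv.
apply: (@le_trans _ _
  (\int[lebesgue_measure]_(x in `[s, (2 * s)%R]) (normal_pdf 0 s (2 * s))%:E)%E).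
  rewrite integral_cst//= lebesgue_measure_itv/= lte_fin ltr_pMl// ltr1n.
  rewrite -EFinB -EFinM lee_fin !normal_pdfE ?oner_neq0// /normal_peak.
  have -> : normal_fun 0 s (2 * s) = normal_fun 0 1 2%:R.
    by rewrite /normal_fun; congr expR; field.
  rewrite le_eqVlt; apply/orP; left; apply/eqP.
  rewrite expr1n mul1r -mulrnAr sqrtrM ?sqr_ge0// sqrtr_sqr gtr0_norm// invfM.
  by field; rewrite sn0 gt_eqF// sqrtr_gt0 mulrn_wgt0// pi_gt0.
apply: ge0_le_integral => //.
- by move=> x _; rewrite lee_fin normal_pdf_ge0.
- by apply/measurable_EFinP/measurable_funTS; exact: measurable_normal_pdf.
- move=> x /=; rewrite in_itv/= => /andP[sx xs]; rewrite lee_fin.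
  rewrite !normal_pdfE// ler_wpM2l ?normal_peak_ge0// ler_expR !subr0.
  rewrite !mulNr lerN2 ler_wpM2r ?invr_ge0 ?mulrn_wge0 ?sqr_ge0//.
  by rewrite ler_sqr ?nnegrE; lra.
Qed.

(** * Splitting a uniform variable into two independent ones *)

(** The distribution function of the uniform law on [0, 1]. *)
Definition unit_clip {R : realType} (x : R) : R := Num.min (Num.max x 0) 1.

Lemma unit_clip_le0 (R : realType) (x : R) : x <= 0 -> unit_clip x = 0.
Proof. by move=> x0; rewrite /unit_clip max_r// min_l. Qed.

Lemma unit_clip_ge1 (R : realType) (x : R) : 1 <= x -> unit_clip x = 1.
Proof. by move=> x1; rewrite /unit_clip max_l ?min_r//; lra. Qed.

Lemma unit_clip_id (R : realType) (x : R) : 0 <= x <= 1 -> unit_clip x = x.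
Proof. by move=> /andP[x0 x1]; rewrite /unit_clip max_l// min_l. Qed.

Lemma uniform_prob_ray (R : realType) (x : R) :
  uniform_prob (@ltr01 R) `]-oo, x]%classic = (unit_clip x)%:E.
Proof.
rewrite /uniform_prob integral_uniform_pdf.
transitivity (\int[lebesgue_measure]_(y in `]-oo, x] `&` `[0%R, 1%R]) (cst 1%E y))%E.
  apply: eq_integral => y /[!inE] -[_ /=]; rewrite in_itv/= /uniform_pdf => ->.
  by rewrite subr0 invr1.
rewrite integral_cst/=; last by apply: measurableI; exact: measurable_itv.
rewrite mul1e.
have -> : `]-oo, x] `&` `[0%R, 1%R] = `[0%R, Num.min x 1]%classic.
  apply/seteqP; split=> y /=; rewrite !in_itv/= le_min.
    by move=> [-> /andP[-> ->]].
  by move=> /and3P[-> -> ->].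
rewrite lebesgue_measure_itv/= lte_fin /unit_clip.
case: ifPn; rewrite lt_min ltr01 andbT; [move=> x0|rewrite -leNgt => x0].
  by rewrite oppr0 adde0 (max_l (ltW x0)).
by rewrite (max_r x0) min_l.
Qed.

(** The strict inequality gives a dyadic point of ]0, 1[ its expansion ending in ones, and makes the
    preimages of rays []-oo, x]] under [doubling] closed on the right. *)
Definition bit {R : realType} (u : measurableTypeR R) : bool := 2^-1 < u.

Definition doubling {R : realType} (u : measurableTypeR R) : measurableTypeR R :=
  2 * u - (bit u)%:R.

Lemma measurable_bit (R : realType) : measurable_fun [set: measurableTypeR R] bit.
Proof. by apply: measurable_fun_ltr. Qed.

Lemma measurable_bitR (R : realType) :
  measurable_fun [set: measurableTypeR R] (fun u => (bit u)%:R : R).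
Proof.
by apply: (measurableT_comp (f := fun b : bool => b%:R : R)) => //; exact: measurable_bit.
Qed.

Lemma measurable_doubling (R : realType) :
  measurable_fun [set: measurableTypeR R] doubling.
Proof.
apply: measurable_funB; last exact: measurable_bitR.
by apply: measurable_funM.
Qed.

(** The first digit is a fair coin independent of the remaining digits, which are again uniform. On
    rays this is a computation: each half of the unit interval is stretched by 2 onto the whole. *)
Lemma uniform_prob_bit_doubling (R : realType) (b : bool) (E : set (measurableTypeR R)) :
  measurable E ->
  uniform_prob (@ltr01 R) (bit @^-1` [set b] `&` doubling @^-1` E) =
  (uniform_prob (@ltr01 R) E * (2^-1)%:E)%E.
Proof.
move=> mE.
have mb : measurable (@bit R @^-1` [set b]).
  by rewrite -[X in measurable X]setTI; exact: measurable_bit.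
have raym (x : R) : measurable (`]-oo, x]%classic : set (measurableTypeR R)).
  exact: measurable_itv.
rewrite setIC muleC; apply: (restricted_law_eq (@measurable_doubling R)) => //.
move=> x; rewrite [X in _ = (_ * X)%E]uniform_prob_ray -EFinM.
case: b {mb}.
  have -> : doubling @^-1` `]-oo, x] `&` bit @^-1` [set true] =
      `]-oo, ((x + 1) / 2)%R] `\` `]-oo, (2^-1)%R].
    apply/seteqP; split=> u /=; rewrite !in_itv/= /doubling /bit.
      by move=> [+ ub]; rewrite ub/= => ux; split; [lra|apply/negP; rewrite -ltNge].
    by move=> [ux /negP]; rewrite -ltNge => ub; rewrite ub/=; split=> //; lra.
  rewrite measureD//; last first.
    exact: le_lt_trans (probability_le1 (uniform_prob (@ltr01 R)) (raym _)) (ltry 1).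
  have -> : `]-oo, ((x + 1) / 2)%R] `&` `]-oo, (2^-1)%R] =
      `]-oo, Num.min ((x + 1) / 2) (2^-1)]%classic.
    by apply/seteqP; split=> u /=; rewrite !in_itv/= le_min => /andP.
  rewrite [X in (X - _)%E]uniform_prob_ray [X in (_ - X)%E]uniform_prob_ray -EFinB; congr EFin.
  have [x0|x0] := lerP x 0.
    by rewrite (unit_clip_le0 x0) min_l ?subrr ?mulr0//; lra.
  rewrite min_r  ?(@unit_clip_id _ 2^-1); [|lra|lra].
  have [x1|x1] := lerP x 1; last by rewrite !unit_clip_ge1; lra.
  by rewrite !unit_clip_id; lra.
have -> : doubling @^-1` `]-oo, x] `&` bit @^-1` [set false] =
    `]-oo, Num.min (x / 2) (2^-1)]%classic.
  apply/seteqP; split=> u /=; rewrite !in_itv/= /doubling /bit le_min.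
    by move=> [+ /negbT]; rewrite -leNgt => + ub; rewrite ltNge ub/= andbT => ux; lra.
  move=> /andP[ux ub]; rewrite ltNge ub/=; split=> //; lra.
rewrite [LHS]uniform_prob_ray; congr EFin.
have [x0|x0] := lerP x 0.
  by rewrite (unit_clip_le0 x0) mulr0 unit_clip_le0// ge_min; apply/orP; left; lra.
have [x1|x1] := lerP x 1.
  by rewrite min_l ?unit_clip_id//; lra.
by rewrite min_r ?(unit_clip_ge1 (ltW x1)) ?unit_clip_id; lra.
Qed.

Lemma uniform_prob_first_bit (R : realType) (F : bool -> set (measurableTypeR R)) :
  (forall b, measurable (F b)) ->
  uniform_prob (@ltr01 R) [set u | F (bit u) (doubling u)] =
  ((uniform_prob (@ltr01 R) (F false) + uniform_prob (@ltr01 R) (F true))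
   * (2^-1)%:E)%E.
Proof.
move=> mF.
have mbF (b : bool) : measurable (@bit R @^-1` [set b] `&` doubling @^-1` F b).
  by apply: measurableI; rewrite -[X in measurable X]setTI;
    [exact: measurable_bit|exact: measurable_doubling].
have -> : [set u | F (bit u) (doubling u)] =
    (bit @^-1` [set false] `&` doubling @^-1` F false) `|`
    (bit @^-1` [set true] `&` doubling @^-1` F true).
  apply/seteqP; split=> u /=; first by case: (bit u); [right|left].
  by move=> [] [-> ].
rewrite measureU//.
  rewrite ge0_muleDl//; congr (_ + _)%E; exact: uniform_prob_bit_doubling.
by apply/seteqP; split=> // u /= [[-> _] []].
Qed.

Lemma uniform_prob_doubling (R : realType) (E : set (measurableTypeR R)) :
  measurable E ->
  uniform_prob (@ltr01 R) (doubling @^-1` E) = uniform_prob (@ltr01 R) E.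
Proof.
move=> mE; rewrite (uniform_prob_first_bit (F := fun=> E))//.
have : uniform_prob (@ltr01 R) E \is a fin_num.
  exact: (@fin_num_measure _ _ _ (uniform_prob (@ltr01 R))).
by move=> /fineK <-; rewrite -EFinD -EFinM; congr EFin; lra.
Qed.

(* [digits u] has the binary digits of [u] of odd rank, hence
   [digits (doubling u)] those of even rank. *)
Fixpoint digits_upto {R : realType} (n : nat) (u : measurableTypeR R) : R :=
  if n is n'.+1 then ((bit u)%:R + digits_upto n' (doubling (doubling u))) / 2
  else 0.

Definition digits {R : realType} (u : measurableTypeR R) : R :=
  limn (fun n => digits_upto n u).

Lemma digits_upto_itv (R : realType) n (u : measurableTypeR R) :
  0 <= digits_upto n u <= 1.
Proof.
elim: n u => [|n IH] u /=; first by rewrite lexx ler01.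
by have := IH (doubling (doubling u)); case: (bit u) => /= /andP[? ?]; lra.
Qed.

Lemma digits_upto_cvg (R : realType) (u : measurableTypeR R) :
  digits_upto n u @[n --> \oo] --> digits u.
Proof.
apply: nondecreasing_is_cvgn.
  apply/nondecreasing_seqP => n.
  elim: n u => [|n IH] u; first by have /andP[] := digits_upto_itv 1 u.
  by rewrite [leLHS]/= [leRHS]/= ler_wpM2r// lerD2l.
exists 1 => _ [n _ <-]; by have /andP[] := digits_upto_itv n u.
Qed.

Lemma digits_itv (R : realType) (u : measurableTypeR R) : 0 <= digits u <= 1.
Proof.
apply/andP; split.
  apply: limr_ge; first by apply: cvgP; exact: digits_upto_cvg.
  apply: nearW => n.
  by have /andP[] := digits_upto_itv n u.
apply: limr_le; first by apply: cvgP; exact: digits_upto_cvg.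
apply: nearW => n.
by have /andP[] := digits_upto_itv n u.
Qed.

Lemma digitsE (R : realType) (u : measurableTypeR R) :
  digits u = ((bit u)%:R + digits (doubling (doubling u))) / 2.
Proof.
have := @digits_upto_cvg R u; rewrite -(cvg_shiftS _) => /cvg_lim <- //.
apply/cvg_lim => //=; apply: cvgMl; apply: cvgD; first exact: cvg_cst.
exact: digits_upto_cvg.
Qed.

Lemma measurable_digits (R : realType) :
  measurable_fun [set: measurableTypeR R] (@digits R).
Proof.
apply: (measurable_fun_cvg (h := @digits_upto R)) => [n|u _]; last exact: digits_upto_cvg.
elim: n => [|n IH]; first exact: measurable_cst.
apply: measurable_funM => //; apply: measurable_funD; first exact: measurable_bitR.
apply: (measurableT_comp IH).
by apply: measurableT_comp; exact: measurable_doubling.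
Qed.

Lemma measurable_digits_le (R : realType) (s : R) :
  measurable [set u : measurableTypeR R | digits u <= s].
Proof.
rewrite -[X in measurable X]setTI.
have := measurable_digits (@measurableT _ (measurableTypeR R)) (measurable_itv `]-oo, s]).
by congr (measurable (_ `&` _)); apply/seteqP; split=> u /=; rewrite in_itv.
Qed.

Lemma measurable_digits_doubling_le (R : realType) (s t : R) :
  measurable [set u : measurableTypeR R | digits u <= s /\ digits (doubling u) <= t].
Proof.
apply: measurableI; first exact: measurable_digits_le.
rewrite -[X in measurable X]setTI.
exact: (@measurable_doubling R measurableT _ (measurable_digits_le t)).
Qed.

(** * Joint law of the digits of odd and even rank *)

Lemma halving_eq0 (R : realType) (a : R) : (forall n, `|a| <= 2^-1 ^+ n) -> a = 0.
Proof.
move=> h; apply/eqP; rewrite -normr_le0.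
have c0 : (2^-1 : R) ^+ n @[n --> \oo] --> (0 : R).
  by apply: cvg_expr; rewrite ger0_norm ?invr_ge0// invf_lt1// ltr1n.
rewrite -(cvg_lim _ c0)//; apply: limr_ge; first by apply: cvgP c0.
exact: nearW.
Qed.

Definition digits_cdf {R : realType} (s t : R) : R :=
  fine (uniform_prob (@ltr01 R) [set u | digits u <= s /\ digits (doubling u) <= t]).

(** Condition on the first two digits of [u]: one leads [digits u], the other leads
    [digits (doubling u)]. The four outcomes are equally likely, and what follows has the same joint
    law at twice the scale. *)
Lemma digits_cdf_rec (R : realType) (s t : R) :
  digits_cdf s t =
  (digits_cdf (2 * s) (2 * t) + digits_cdf (2 * s) (2 * t - 1) +
   digits_cdf (2 * s - 1) (2 * t) + digits_cdf (2 * s - 1) (2 * t - 1)) / 4.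
Proof.
pose E (a b : bool) := [set u : measurableTypeR R |
  digits u <= 2 * s - a%:R /\ digits (doubling u) <= 2 * t - b%:R].
have mE a b : measurable (E a b) by exact: measurable_digits_doubling_le.
(* The second digit is peeled off inside the event left by the first, so that
   [uniform_prob_first_bit] applies twice. *)
pose F (a : bool) := [set v : measurableTypeR R | E a (bit v) (doubling v)].
have mF a : measurable (F a).
  have -> : F a = (bit @^-1` [set false] `&` doubling @^-1` E a false) `|`
    (bit @^-1` [set true] `&` doubling @^-1` E a true).
    apply/seteqP; split=> u; rewrite /F /=; first by case: (bit u); [right|left].
    by move=> [] [-> ].
  by apply: measurableU; apply: measurableI; rewrite -[X in measurable X]setTI;
    [exact: measurable_bit|exact: measurable_doubling|
     exact: measurable_bit|exact: measurable_doubling].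
have fE a b : uniform_prob (@ltr01 R) (E a b) =
    (digits_cdf (2 * s - a%:R) (2 * t - b%:R))%:E.
  rewrite fineK//.
  exact: (@fin_num_measure _ _ _ (uniform_prob (@ltr01 R)) _ (mE a b)).
rewrite /digits_cdf [X in uniform_prob _ X](_ : _ = [set u | F (bit u) (doubling u)]).
  rewrite uniform_prob_first_bit// !(uniform_prob_first_bit (F := E _))// !fE/= !subr0.
  by rewrite -!/(digits_cdf _ _); field.
by apply/seteqP; split=> u /=; rewrite /F /E /= (digitsE u) (digitsE (doubling u))/=;
  move=> [? ?]; split; lra.
Qed.

Lemma digits_cdf_itv (R : realType) (s t : R) : 0 <= digits_cdf s t <= 1.
Proof.
apply/andP; split; first by rewrite fine_ge0// measure_ge0.
rewrite -lee_fin fineK; last first.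
  exact: (@fin_num_measure _ _ _ (uniform_prob (@ltr01 R)) _
    (measurable_digits_doubling_le s t)).
exact: (probability_le1 (uniform_prob (@ltr01 R)) (measurable_digits_doubling_le s t)).
Qed.

Lemma digits_cdf_lt0 (R : realType) (s t : R) : s < 0 \/ t < 0 -> digits_cdf s t = 0.
Proof.
move=> st0; rewrite /digits_cdf (_ : mkset _ = set0) ?measure0//.
apply/seteqP; split=> // u /= [us ut].
have /andP[? _] := digits_itv u; have /andP[? _] := digits_itv (doubling u).
by case: st0; lra.
Qed.

Lemma digits_cdf_ge1l (R : realType) (s t : R) : 1 <= s -> digits_cdf s t = digits_cdf 1 t.
Proof.
move=> s1; rewrite /digits_cdf; congr (fine (uniform_prob _ _)).
apply/seteqP; split=> u /= [us ut]; split=> //; have /andP[_ ?] := digits_itv u; lra.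
Qed.

Lemma digits_cdf_ge1r (R : realType) (s t : R) : 1 <= t -> digits_cdf s t = digits_cdf s 1.
Proof.
move=> s1; rewrite /digits_cdf; congr (fine (uniform_prob _ _)).
apply/seteqP; split=> u /= [us ut]; split=> //; have /andP[_ ?] := digits_itv (doubling u); lra.
Qed.

Lemma digits_cdf11 (R : realType) : digits_cdf 1 1 = 1 :> R.
Proof.
rewrite /digits_cdf (_ : mkset _ = setT).
  exact: (congr1 fine (probability_setT (uniform_prob (@ltr01 R)))).
apply/seteqP; split=> // u _ /=.
by have /andP[_ ?] := digits_itv u; have /andP[_ ?] := digits_itv (doubling u).
Qed.

(* Both sides satisfy the self-similarity relation [digits_cdf_rec], under
   which a deviation on the unit square is at least halved. *)
Lemma digits_cdf1r (R : realType) (s : R) : digits_cdf s 1 = unit_clip s.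
Proof.
apply/eqP; rewrite -subr_eq0; apply/eqP/halving_eq0 => n.
elim: n s => [|n IH] s.
  have /andP[? ?] := digits_cdf_itv s 1.
  rewrite expr0 ler_norml; have [s0|s0] := lerP s 0; first by rewrite unit_clip_le0//; lra.
  have [s1|s1] := lerP s 1; first by rewrite unit_clip_id; lra.
  by rewrite unit_clip_ge1; lra.
have [s0|s0] := ltrP s 0.
  by rewrite digits_cdf_lt0; [rewrite unit_clip_le0 ?subrr ?normr0 ?exprn_ge0; lra|left].
have [s1|s1] := lerP 1 s.
  by rewrite digits_cdf_ge1l// digits_cdf11 unit_clip_ge1// subrr normr0 exprn_ge0; lra.
rewrite digits_cdf_rec.
rewrite [digits_cdf (2 * s) (2 * 1)]digits_cdf_ge1r; last lra.
rewrite [digits_cdf (2 * s - 1) (2 * 1)]digits_cdf_ge1r; last lra.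
have -> : 2 * 1 - 1 = 1 :> R by lra.
rewrite exprS (@unit_clip_id _ s); last lra.
(* In either half, two of the four terms of the recursion are known (0 or 1) and the other two
   coincide, so the deviation is inherited with weight 2/4. *)
have [s2|s2] := ltrP s (2^-1).
  rewrite (@digits_cdf_lt0 _ (2 * s - 1)); last by left; lra.
  have := IH (2 * s); rewrite unit_clip_id ?ler_norml; last lra.
  by move=> ?; lra.
rewrite (@digits_cdf_ge1l _ (2 * s)) ?digits_cdf11; last lra.
have := IH (2 * s - 1); rewrite unit_clip_id ?ler_norml; last lra.
by move=> ?; lra.
Qed.

(** The second marginal equals the first, because [doubling] preserves the uniform law. *)
Lemma digits_cdf1l (R : realType) (t : R) : digits_cdf 1 t = unit_clip t.
Proof.
rewrite -digits_cdf1r /digits_cdf.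
transitivity (fine (uniform_prob (@ltr01 R) [set u | digits (doubling u) <= t])).
  congr (fine (uniform_prob _ _)); apply/seteqP; split=> u /=; first by case.
  by move=> ut; split=> //; have /andP[] := digits_itv u.
rewrite -[X in uniform_prob _ X]/(doubling @^-1` [set u | digits u <= t]).
rewrite uniform_prob_doubling; last exact: measurable_digits_le.
congr (fine (uniform_prob _ _)); apply/seteqP; split=> u /=; last by case.
by move=> ut; split=> //; have /andP[] := digits_itv (doubling u).
Qed.

(** Off the unit square the claim reduces to the marginals. In each quarter of the square, three of
    the four terms of the recursion vanish or are marginals; the remaining one carries the deviation
    with weight 1/4, more than the induction requires. *)
Lemma digits_cdfE (R : realType) (s t : R) : digits_cdf s t = unit_clip s * unit_clip t.
Proof.
apply/eqP; rewrite -subr_eq0; apply/eqP/halving_eq0 => n.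
have e0 k : 0 <= 2^-1 ^+ k :> R by rewrite exprn_ge0// invr_ge0.
elim: n s t => [|n IH] s t.
  have /andP[? ?] := digits_cdf_itv s t.
  have ? : 0 <= unit_clip s * unit_clip t <= 1.
    rewrite -!digits_cdf1r; have /andP[? ?] := digits_cdf_itv s 1.
    by have /andP[? ?] := digits_cdf_itv t 1; nra.
  by rewrite expr0 ler_norml; lra.
have [s0|s0] := ltrP s 0.
  by rewrite digits_cdf_lt0; [rewrite (@unit_clip_le0 _ s) ?mul0r ?subrr ?normr0 ?e0; lra|left].
have [t0|t0] := ltrP t 0.
  by rewrite digits_cdf_lt0; [rewrite (@unit_clip_le0 _ t) ?mulr0 ?subrr ?normr0 ?e0; lra|right].
have [s1|s1] := lerP 1 s.
  by rewrite digits_cdf_ge1l// digits_cdf1l (unit_clip_ge1 s1) mul1r subrr normr0.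
have [t1|t1] := lerP 1 t.
  by rewrite digits_cdf_ge1r// digits_cdf1r (unit_clip_ge1 t1) mulr1 subrr normr0.
rewrite digits_cdf_rec exprS (@unit_clip_id _ s) ?(@unit_clip_id _ t); [|lra..].
have [s2|s2] := ltrP s (2^-1); have [t2|t2] := ltrP t (2^-1).
- rewrite (@digits_cdf_lt0 _ (2 * s)  (2 * t - 1)); last by right; lra.
  rewrite !(@digits_cdf_lt0 _ (2 * s - 1)); [|left; lra..].
  have := IH (2 * s) (2 * t); rewrite !unit_clip_id ?ler_norml; [|lra..].
  by move=> ?; lra.
- rewrite (@digits_cdf_ge1r _ _ (2 * t)) ?digits_cdf1r; last lra.
  rewrite !(@digits_cdf_lt0 _ (2 * s - 1)); [|left; lra..].
  have := IH (2 * s) (2 * t - 1); rewrite !unit_clip_id ?ler_norml; [|lra..].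
  by move=> ?; lra.
- rewrite (@digits_cdf_ge1l _ (2 * s)) ?digits_cdf1l; last lra.
  rewrite !(@digits_cdf_lt0 _ _ (2 * t - 1)); [|right; lra..].
  have := IH (2 * s - 1) (2 * t); rewrite !unit_clip_id ?ler_norml; [|lra..].
  by move=> ?; lra.
- rewrite !(@digits_cdf_ge1l _ (2 * s)) ?digits_cdf1l; [|lra..].
  rewrite (@digits_cdf_ge1r _ _ (2 * t)) ?digits_cdf1r; last lra.
  rewrite (@unit_clip_ge1 _ (2 * t)); last lra.
  have := IH (2 * s - 1) (2 * t - 1); rewrite !unit_clip_id ?ler_norml; [|lra..].
  by move=> ?; lra.
Qed.

Lemma digits_doubling_independent (R : realType) (B E : set (measurableTypeR R)) :
  measurable B -> measurable E ->
  uniform_prob (@ltr01 R) (digits @^-1` B `&` (digits \o doubling) @^-1` E) =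
  (uniform_prob (@ltr01 R) B * uniform_prob (@ltr01 R) E)%E.
Proof.
move=> mB mE.
have clip0 (x : R) : 0 <= unit_clip x.
  by rewrite -digits_cdf1r; have /andP[] := digits_cdf_itv x 1.
have mX : measurable_fun [set: measurableTypeR R] (digits \o @doubling R).
  by apply: measurableT_comp; [exact: measurable_digits|exact: measurable_doubling].
have rayE (x : R) (f : measurableTypeR R -> measurableTypeR R) :
    f @^-1` `]-oo, x]%classic = [set u | f u <= x].
  by apply/seteqP; split=> u /=; rewrite in_itv.
(* Rays are replaced by Borel sets one coordinate at a time: here in the first, with the event on
   the second held fixed; afterwards in the second, with [B] held fixed. *)
have rectB (t : R) : uniform_prob (@ltr01 R)
    (digits @^-1` B `&` (digits \o doubling) @^-1` `]-oo, t]) =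
    ((unit_clip t)%:E * uniform_prob (@ltr01 R) B)%E.
  apply: (restricted_law_eq (@measurable_digits R)) => //.
    by rewrite -[X in measurable X]setTI; apply: mX => //; exact: measurable_itv.
  move=> s; rewrite [X in _ = (_ * X)%E]uniform_prob_ray -EFinM mulrC -digits_cdfE.
  rewrite fineK ?rayE//.
  exact: (@fin_num_measure _ _ _ (uniform_prob (@ltr01 R)) _
    (measurable_digits_doubling_le s t)).
have PB : uniform_prob (@ltr01 R) B \is a fin_num.
  exact: (@fin_num_measure _ _ _ (uniform_prob (@ltr01 R)) _ mB).
rewrite setIC -(fineK PB); apply: (restricted_law_eq mX) => //.
- by rewrite -[X in measurable X]setTI; apply: measurable_digits.
- by rewrite fine_ge0// measure_ge0.
- move=> t; rewrite setIC [LHS]rectB muleC fineK//.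
  by congr (_ * _)%E; rewrite [RHS]uniform_prob_ray.
Qed.

(** * Quantile transform *)

(** The uniform law is carried by the open interval, the only place where a quantile function is
    controlled: at 0 and 1 it may be infinite. *)
Lemma uniform_prob_eq (R : realType) (A B : set (measurableTypeR R)) :
  measurable A -> measurable B -> (forall u, 0 < u < 1 -> A u <-> B u) ->
  uniform_prob (@ltr01 R) A = uniform_prob (@ltr01 R) B.
Proof.
pose D : set (measurableTypeR R) := `]0, 1[%classic.
have mD : measurable D by exact: measurable_itv.
have PD : uniform_prob (@ltr01 R) D = 1%E.
  rewrite /uniform_prob.
  transitivity (\int[lebesgue_measure]_(y in D) (cst 1%E y))%E.
    apply: eq_integral => y; rewrite inE /D /= in_itv/= => /andP[y0 y1].
    by rewrite /uniform_pdf (ltW y0) (ltW y1) subr0 invr1.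
  by rewrite integral_cst//= /D lebesgue_measure_itv/= lte_fin ltr01 oppr0 adde0 mule1.
have PDC : uniform_prob (@ltr01 R) (~` D) = 0%E.
  have := probability_setC (uniform_prob (@ltr01 R)) mD.
  by rewrite [X in (1 - X)%E]PD subee.
have PI A' : measurable A' -> uniform_prob (@ltr01 R) A' = uniform_prob (@ltr01 R) (A' `&` D).
  move=> mA'; rewrite -[in LHS](setUIDK A' D) measureU//.
  - rewrite [X in (_ + X)%E](_ : _ = 0%E) ?adde0//.
    apply/eqP; rewrite -measure_le0 -[leRHS]PDC; apply: le_measure; rewrite ?inE; last by move=> u [].
      exact: measurableD.
    exact: measurableC.
  - exact: measurableI.
  - exact: measurableD.
  - by apply/seteqP; split=> // u [[_ Du] [_ /(_ Du)]].
move=> mA mB AB; rewrite (PI A)// (PI B)//; congr (uniform_prob _ _).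
by apply/seteqP; split=> u [] /[swap]; rewrite /D /= in_itv/= => u01 /(AB u u01).
Qed.

Lemma measurable_fun_rays (R : realType) d (T : measurableType d) (f : T -> R) :
  (forall x, measurable (f @^-1` `]-oo, x])) -> measurable_fun setT f.
Proof.
move=> mf; apply: (measurability _ (RGenOInfty.measurableE R)) => _ [_ [x ->] <-].
rewrite setTI -setCitvl preimage_setC; exact/measurableC/mf.
Qed.

Lemma uniform_prob_quantile (R : realType) (Q : probability (measurableTypeR R) R) :
  exists2 q : measurableTypeR R -> measurableTypeR R, measurable_fun setT q &
    forall B, measurable B -> uniform_prob (@ltr01 R) (q @^-1` B) = Q B.
Proof.
have mid : measurable_fun [set: measurableTypeR R] (idfun : measurableTypeR R -> R).
  exact: measurable_id.
pose X : {RV Q >-> R} := HB.pack (idfun : measurableTypeR R -> R)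
  (isMeasurableFun.Build _ _ _ _ _ mid).
pose F (x : R) : R := fine (Q `]-oo, x]%classic).
have mray (x : R) : measurable (`]-oo, x]%classic : set (measurableTypeR R)).
  exact: measurable_itv.
have FE x : (F x)%:E = cdf X x.
  by rewrite fineK//; exact: fin_num_measure.
have F01 x : 0 <= F x <= 1.
  by rewrite -!lee_fin FE cdf_ge0 cdf_le1.
have Fnd x y : x <= y -> F x <= F y.
  by move=> xy; rewrite -lee_fin !FE; exact: cdf_nondecreasing.
have F_lt (u : R) : 0 < u -> exists y, F y < u.
  move=> u0; apply: contrapT => /forallNP h.
  suff : (u%:E <= 0)%E by rewrite lee_fin leNgt u0.
  apply: (cvge_to_ge (cvg_cdfNy0 X)); apply: nearW => y.
  by rewrite -FE lee_fin leNgt; apply/negP; exact: h.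
have F_ge (u : R) : u < 1 -> exists y, u <= F y.
  move=> u1; apply: contrapT => /forallNP h.
  suff : (1 <= u%:E)%E by rewrite lee_fin leNgt u1.
  apply: (cvge_to_le (cvg_cdfy1 X)); apply: nearW => y.
  by rewrite -FE lee_fin ltW// ltNge; apply/negP; exact: h.
(* Outside ]0, 1[ the set may be empty or unbounded, hence the default value 0, which accounts for
   the second piece of [qrayE]. *)
pose q (u : measurableTypeR R) : measurableTypeR R :=
  if 0 < u < 1 then sup [set x | F x < u] else 0.
(* The Galois connection between [q] and [F]: the event [q u <= x] becomes [u <= F x], of uniform
   probability [F x]. *)
have qP u x : 0 < u < 1 -> (q u <= x) = (u <= F x).
  move=> /[dup] u01 /andP[u0 u1]; rewrite /q u01.
  have [y0 Fy0] := F_lt u u0; have [y1 Fy1] := F_ge u u1.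
  have ubS z : u <= F z -> ubound [set x | F x < u] z.
    by move=> uz w /= Fw; rewrite leNgt; apply/negP => /ltW/Fnd; lra.
  apply/idP/idP => [qx|ux]; last first.
    by apply: ge_sup; [exists y0|exact: ubS].
  (* Every y > x exceeds the supremum, so [u <= F y]; right continuity of [F] carries this to
     [x]. *)
  rewrite -lee_fin FE.
  apply: (cvge_to_ge (@cdf_right_continuous _ _ _ _ X x)).
  near=> y; rewrite -FE lee_fin leNgt; apply/negP => Fy.
  have : y <= x by apply: le_trans qx; apply: ub_le_sup => //; exists y1; exact: ubS.
  by rewrite leNgt => /negP; apply; near: y; exact: nbhs_right_gt.
have qrayE x : q @^-1` `]-oo, x] = (`]0, 1[ `&` `]-oo, F x]) `|`
    (~` `]0, 1[ `&` (if 0 <= x then setT else set0)).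
  apply/seteqP; split=> u /=; rewrite !in_itv/=; have [u01|u01] := boolP (0 < u < 1).
  - by rewrite qP//; left.
  - by rewrite /q (negbTE u01) => ->; right; split=> //; apply/negP.
  - by rewrite qP// => -[[]|[]].
  - by rewrite /q (negbTE u01) => -[[]//|[_]]; case: ifP.
have mqray x : measurable (q @^-1` `]-oo, x]).
  rewrite qrayE; apply: measurableU; apply: measurableI => //.
  - by apply: measurableC; exact: measurable_itv.
  - by case: ifP => _; [exact: measurableT|exact: measurable0].
have mq : measurable_fun setT q by exact: measurable_fun_rays.
exists q => // B mB.
have := @restricted_law_eq _ _ _ (uniform_prob (@ltr01 R)) q setT Q 1 mq measurableT ler01.
rewrite /= => /(_ _ B mB); rewrite setIT mul1e; apply => x.
rewrite setIT mul1e (@uniform_prob_eq _ _ `]-oo, F x]) => //.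
  rewrite uniform_prob_ray /unit_clip; have /andP[? ?] := F01 x.
  by rewrite max_l// min_l// FE.
by move=> u u01; rewrite /= !in_itv/= qP.
Unshelve. all: end_near. Qed.

(** * Bernoulli shifts *)

Section bernoulli_shift.
Context {R : realType} d {T : measurableType d} (P : probability T R).
Context (Q : probability (measurableTypeR R) R).
Context (h : T -> measurableTypeR R) (V : T -> T).
Hypothesis mh : measurable_fun setT h.
Hypothesis mV : measurable_fun setT V.
(** Three facts in one identity: [h] has law [Q] (full [E]), [V] preserves [P] (full [B]), and [h]
    is independent of [V]. *)
Hypothesis hVP : forall (B : set (measurableTypeR R)) (E : set T),
  measurable B -> measurable E ->
  P (h @^-1` B `&` V @^-1` E) = (Q B * P E)%E.

Lemma measurable_iter_shift i : measurable_fun setT (iter i V).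
Proof.
elim: i => [|i IH]; first exact: measurable_id.
exact: (measurableT_comp mV IH).
Qed.

Lemma shift_preserving E : measurable E -> P (V @^-1` E) = P E.
Proof.
by move=> mE; have := hVP measurableT mE; rewrite preimage_setT setTI probability_setT mul1e.
Qed.

Lemma iter_shift_preserving i E : measurable E -> P (iter i V @^-1` E) = P E.
Proof.
move=> mE; elim: i => [//|i IH].
rewrite (_ : _ @^-1` _ = V @^-1` (iter i V @^-1` E)).
  rewrite shift_preserving//.
  by rewrite -[X in measurable X]setTI; apply: measurable_iter_shift.
by apply/seteqP; split=> w; rewrite /preimage/= -iterS iterSr.
Qed.

Lemma shift_sequence_law i B : measurable B -> P ((h \o iter i V) @^-1` B) = Q B.
Proof.
move=> mB; rewrite comp_preimage iter_shift_preserving; last first.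
  by rewrite -[X in measurable X]setTI; apply: mh.
have := hVP mB measurableT.
by rewrite preimage_setT setIT probability_setT mule1.
Qed.

Lemma measurable_shift_prefix n (B : nat -> set (measurableTypeR R)) :
  (forall i, measurable (B i)) ->
  measurable [set w | forall i, (i < n)%N -> B i (h (iter i V w))].
Proof.
move=> mB.
have -> : [set w | forall i, (i < n)%N -> B i (h (iter i V w))] =
    \bigcap_(i < n) ((h \o iter i V) @^-1` B i) by [].
apply: bigcap_measurableType => i _; rewrite -[X in measurable X]setTI.
exact: (measurableT_comp mh (measurable_iter_shift i) measurableT (mB i)).
Qed.

(** The constraint on [h w] splits off by [hVP]; the others form an event on [V w] of the same shape
    for the shifted family of sets, so the induction is over all [B]. *)
Lemma shift_sequence_prefix n (B : nat -> set (measurableTypeR R)) :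
  (forall i, measurable (B i)) ->
  P [set w | forall i, (i < n)%N -> B i (h (iter i V w))] = (\prod_(i < n) Q (B i))%E.
Proof.
elim: n B => [|n IH] B mB.
  by rewrite big_ord0 -[RHS](probability_setT P); congr (P _); apply/seteqP; split.
rewrite big_ord_recl -(IH (fun i => B i.+1))// -hVP//; last first.
  exact: (measurable_shift_prefix n (fun i => mB i.+1)).
congr (P _); apply/seteqP; split=> [w Bw|w [/= B0 BS] [|i]]//.
  by split; [exact: (Bw 0)|move=> i ni; rewrite -iterSr; exact: Bw].
by move=> ni; rewrite iterSr; exact: BS.
Qed.

Lemma shift_sequence_independent (s : seq nat) (B : nat -> set (measurableTypeR R)) :
  uniq s -> (forall i, i \in s -> measurable (B i)) ->
  P (\bigcap_(i in [set` s]) ((h \o iter i V) @^-1` B i)) = (\prod_(i <- s) Q (B i))%E.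
Proof.
move=> us mB; pose n := (\max_(i <- s) i).+1.
have sn i : i \in s -> (i < n)%N by move=> si; rewrite ltnS; exact: leq_bigmax_seq.
(* Indices missing from [s] receive the full space, which has probability 1, and [s] is completed to
   an initial segment. *)
pose B' i := if i \in s then B i else setT.
have -> : \bigcap_(i in [set` s]) ((h \o iter i V) @^-1` B i) =
    [set w | forall i, (i < n)%N -> B' i (h (iter i V w))].
  apply/seteqP; split=> w /= Bw i; first by rewrite /B'; case: ifPn => // /Bw.
  by move=> /= si; have := Bw i (sn i si); rewrite /B' si.
rewrite shift_sequence_prefix; last first.
  by move=> i; rewrite /B'; case: ifPn => [/mB//|_]; exact: measurableT.
rewrite -(big_mkord xpredT (fun i => Q (B' i))) (bigID (mem s))/= [X in (_ * X)%E]big1 ?mule1.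
  rewrite -big_filter; under eq_big_seq.
    by move=> i; rewrite mem_filter /B' => /andP[-> _]; over.
  apply: perm_big; apply: uniq_perm => //; first by rewrite filter_uniq// iota_uniq.
  by move=> i; rewrite mem_filter mem_index_iota; case: (boolP (i \in s)) => //= /sn.
by move=> i /negbTE si; rewrite /B' si; exact: probability_setT.
Qed.

Lemma measurable_shift_sum n :
  measurable_fun setT (fun w => \sum_(i < n) h (iter i V w) : measurableTypeR R).
Proof.
have : measurable_fun setT (fun w => \sum_(i < n) h (iter i V w) : R).
  by apply: measurable_sum => i; exact: (measurableT_comp mh (measurable_iter_shift i)).
by move=> H; apply: H.
Qed.

End bernoulli_shift.

Section normal_shift.
Context {R : realType} d {T : measurableType d} (P : probability T R).
Context (h : T -> measurableTypeR R) (V : T -> T).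
Hypothesis mh : measurable_fun setT h.
Hypothesis mV : measurable_fun setT V.
Hypothesis hVP : forall (B : set (measurableTypeR R)) (E : set T),
  measurable B -> measurable E ->
  P (h @^-1` B `&` V @^-1` E) = (normal_prob 0 1 B * P E)%E.

(** The sum is [h w] plus the shorter sum taken at [V w]. By [hVP] and induction this pair has the
    product law, and convolution adds the variances. Starting at one term keeps the standard
    deviations positive. *)
Lemma normal_shift_sum_law n (B : set (measurableTypeR R)) : measurable B ->
  P [set w | B (\sum_(i < n.+1) h (iter i V w))] =
  normal_prob 0 (Num.sqrt n.+1%:R) B.
Proof.
elim: n B => [|n IH] B mB.
  rewrite sqrtr1 -(shift_sequence_law mh mV hVP 0 mB); congr (P _).
  by apply/seteqP; split=> w /=; rewrite big_ord1.
pose S w : measurableTypeR R := \sum_(i < n.+1) h (iter i V w).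
have mS : measurable_fun setT S := measurable_shift_sum mh mV n.+1.
pose X w : measurableTypeR R * measurableTypeR R := (h w, S (V w)).
have mX : measurable_fun setT X.
  by apply: measurable_fun_pair => //; exact: measurableT_comp.
pose push : {measure set (measurableTypeR R * measurableTypeR R) -> \bar R} :=
  pushforward P X.
have n0 : 0 < Num.sqrt n.+1%:R :> R by rewrite sqrtr_gt0 ltr0n.
have mB2 : measurable [set z : measurableTypeR R * measurableTypeR R | B (z.1 + z.2)].
  have madd : measurable_fun setT
      (fun z : measurableTypeR R * measurableTypeR R => (z.1 + z.2 : measurableTypeR R)).
    by apply: measurable_funD.
  by rewrite -[X in measurable X]setTI; exact: (madd measurableT _ mB).
transitivity (push mX [set z | B (z.1 + z.2)]).
  have XE w : \sum_(i < n.+2) h (iter i V w) = h w + S (V w).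
    by rewrite big_ord_recl; congr (_ + _); apply: eq_bigr => i _; rewrite -iterSr.
  by congr (P _); apply/seteqP; split=> w /=; rewrite XE.
rewrite -(@product_measure_unique _ _ _ _ _ (normal_prob 0 1)
  (normal_prob 0 (Num.sqrt n.+1%:R)))//; last first.
  move=> A C mA mC; transitivity (normal_prob 0 1 A * P (S @^-1` C))%E.
    by apply: hVP => //; rewrite -[X in measurable X]setTI; exact: mS.
  by congr (_ * _)%E; exact: IH.
apply: etrans (normal_convolution ltr01 n0 mB) _; congr (normal_prob 0 _ B).
by rewrite expr1n sqr_sqrtr ?ler0n// -natr1 addrC -natr1.
Qed.

End normal_shift.

(** * The two-point random number of terms *)

Lemma uniform_prob_digits_le (R : realType) (p : R) : 0 <= p <= 1 ->
  uniform_prob (@ltr01 R) [set u | digits u <= p] = p%:E.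
Proof.
move=> p01; rewrite -[in RHS](unit_clip_id p01) -digits_cdf1r fineK; last first.
  exact: (@fin_num_measure _ _ _ (uniform_prob (@ltr01 R)) _
    (measurable_digits_doubling_le p 1)).
congr (uniform_prob _ _); apply/seteqP; split=> u /=; last by case.
by move=> up; split=> //; have /andP[] := digits_itv (doubling u).
Qed.

(** Here [m] is N - 1; the larger value is taken with probability 1/m because [digits u] is
    uniform. *)
Definition two_point {R : realType} (m : nat) (u : measurableTypeR R) : nat :=
  if digits u <= m%:R^-1 then m.+1 else 1.

(** Brings every event about the number of terms to the form to which [digits_doubling_independent]
    applies. *)
Lemma two_point_preimage (R : realType) (m : nat) (B : set nat) :
  exists2 A : set (measurableTypeR R), measurable A & two_point m @^-1` B = digits @^-1` A.
Proof.
exists ((`]-oo, m%:R^-1] `&` (if m.+1 \in B then setT else set0)) `|`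
  (~` `]-oo, m%:R^-1] `&` (if 1%N \in B then setT else set0))).
  apply: measurableU; apply: measurableI.
  - exact: measurable_itv.
  - by case: ifP => _; [exact: measurableT|exact: measurable0].
  - by apply: measurableC; exact: measurable_itv.
  - by case: ifP => _; [exact: measurableT|exact: measurable0].
apply/seteqP; split=> u; rewrite /two_point /= in_itv/=;
  have [um|um] := boolP (digits u <= m%:R^-1).
- by move=> B1; left; split=> //; rewrite mem_set.
- by move=> B1; right; split; [exact/negP|rewrite mem_set].
- by move=> [[_]|[]//]; case: ifP => // mB _; exact: set_mem mB.
- by move=> [[]//|[_]]; case: ifP => // mB _; exact: set_mem mB.
Qed.

Lemma measurable_two_point (R : realType) (m : nat) :
  measurable_fun [set: measurableTypeR R] (two_point m).
Proof.
move=> _ B _; rewrite setTI; have [A mA ->] := @two_point_preimage R m B.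
by rewrite -[X in measurable X]setTI; apply: measurable_digits.
Qed.

HB.instance Definition _ (R : realType) (m : nat) :=
  isMeasurableFun.Build _ _ _ _ (@two_point R m) (@measurable_two_point R m).

Lemma expectation_two_point (R : realType) (m : nat) : (0 < m)%N ->
  ('E_(uniform_prob (@ltr01 R)) [fun w => (two_point m w)%:R : R] = 2%:E)%E.
Proof.
move=> m0; have m1 : 1 <= m%:R :> R by rewrite ler1n.
pose A : set (measurableTypeR R) := [set u | digits u <= m%:R^-1].
have mA : measurable A := @measurable_digits_le R m%:R^-1.
rewrite unlock.
transitivity (\int[uniform_prob (@ltr01 R)]_w (cst 1%E w + (m%:R)%:E * (\1_A w)%:E))%E.
  apply: eq_integral => u _; rewrite /two_point indicE -EFinM -EFinD.
  congr EFin; case: ifPn => uA; first by rewrite mem_set// mulr1 -natr1 addrC.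
  by rewrite memNset ?mulr0 ?addr0//; apply/negP.
rewrite ge0_integralD//; last first.
  apply: emeasurable_funM => //; apply/measurable_EFinP; exact: measurable_indic.
rewrite integral_cst// mul1e ge0_integralZl//; last first.
  by apply/measurable_EFinP; exact: measurable_indic.
rewrite integral_indic// setIT [X in (X + _)%E]probability_setT.
rewrite [X in (_ * X)%E]uniform_prob_digits_le ?invr_ge0 ?ler0n ?invf_le1 ?ltr0n//.
by rewrite -EFinM -EFinD divff ?gt_eqF ?ltr0n.
Qed.

(** * Realization of the example and its tail *)

Lemma sigma_of_sequence_preimage (R : realType) d (T : measurableType d)
    (P : probability T R) (xi : nat -> {RV P >-> R}) (V : T -> T) (g : nat -> T -> R) :
  (forall i, measurable_fun setT (g i)) -> (forall i w, xi i w = g i (V w)) ->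
  forall E, sigma_of_sequence P xi E -> exists2 E0, measurable E0 & E = V @^-1` E0.
Proof.
move=> mg xig E sE.
(* Preimages under [V] form a sigma-algebra, and it contains the generators since each [xi i] is a
   function of [V w]. *)
suff : preimage_set_system setT V measurable E.
  by move=> [E0 mE0 <-]; exists E0 => //; rewrite setTI.
move: E sE; apply: smallest_sub.
  exact/sigma_algebra_preimage/sigma_algebra_measurable.
move=> _ [i _ [B mB <-]]; exists (g i @^-1` B).
  by rewrite -[X in measurable X]setTI; exact: mg.
by rewrite !setTI; apply/seteqP; split=> w; rewrite /= xig.
Qed.

Lemma two_point_tail_value (R : realType) (m : nat) (x : R) : (0 < m)%N ->
  2 * x ^+ 2 <= m.+1%:R ->
  exists2 t, tail_values x t & ((normal_pdf 0 1 2%:R / m%:R)%:E <= t)%E.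
Proof.
move=> m0 xm; pose T := measurableTypeR R.
pose P : probability T R := uniform_prob (@ltr01 R).
have [q mq qlaw] := uniform_prob_quantile (normal_prob 0 1 : probability T R).
pose h : T -> T := q \o digits.
pose V : T -> T := digits \o @doubling R.
have mdig : measurable_fun setT (digits : T -> T) := @measurable_digits R.
have mh : measurable_fun setT h by exact: measurableT_comp.
have mV : measurable_fun setT V.
  by apply: measurableT_comp => //; exact: measurable_doubling.
have mpre (f : T -> T) B : measurable_fun setT f -> measurable B -> measurable (f @^-1` B).
  by move=> mf mB; rewrite -[X in measurable X]setTI; exact: mf.
have digV A E : measurable A -> measurable E ->
    P (digits @^-1` A `&` V @^-1` E) = (P (digits @^-1` A) * P E)%E.
  move=> mA mE; rewrite [LHS]digits_doubling_independent//; congr (_ * _)%E; apply: esym.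
  transitivity (P (digits @^-1` A `&` V @^-1` setT)); first by rewrite preimage_setT setIT.
  apply: etrans (digits_doubling_independent mA measurableT) _.
  by rewrite [X in (_ * X)%E](probability_setT P) mule1.
have hVP (B : set T) E : measurable B -> measurable E ->
    P (h @^-1` B `&` V @^-1` E) = (normal_prob 0 1 B * P E)%E.
  move=> mB mE; rewrite -qlaw//.
  have mqB : measurable (q @^-1` B) by exact: mpre.
  exact: (@digits_doubling_independent R (q @^-1` B) E mqB mE).
have mxi i : measurable_fun [set: T] (h \o iter i.+1 V : T -> R).
  exact: (measurableT_comp mh (measurable_iter_shift mV i.+1)).
(* The exponent starts at 1: every [xi i] factors through [V], hence is independent of [digits],
   which determines [eta]. *)
pose xi i : {RV P >-> R} := HB.pack (h \o iter i.+1 V : T -> R)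
  (isMeasurableFun.Build _ _ _ _ _ (mxi i)).
have xilaw i (B : set T) : measurable B -> P (xi i @^-1` B) = normal_prob 0 1 B.
  by move=> mB; exact: (shift_sequence_law mh mV hVP i.+1 mB).
pose eta : {RV P >-> nat} := @two_point R m.
exists (two_sided_tail P (random_sum P 2 xi eta) x).
  exists 2, _, T, P, xi, eta; split=> //.
  - split; last by move=> i B mB; exact: xilaw.
    move=> s B us mB.
    have -> : \bigcap_(i in [set` s]) (xi i @^-1` B i) =
        V @^-1` (\bigcap_(i in [set` s]) ((h \o iter i V) @^-1` B i)).
      by apply/seteqP; split=> w Bw i si; have := Bw i si; rewrite /= -iterS iterSr.
    rewrite (shift_preserving hVP); last first.
      apply: bigcap_measurableType => i si.
      apply: mpre; last exact: mB.
      exact: (measurableT_comp mh (measurable_iter_shift mV i)).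
    rewrite (shift_sequence_independent mh mV hVP us mB).
    by apply: eq_big_seq => i si; rewrite xilaw//; exact: mB.
  - by move=> w; rewrite /eta/= /two_point; case: ifP.
  - move=> B E sE.
    have [A mA AE] := @two_point_preimage R m B.
    have [E0 mE0 EE] : exists2 E0, measurable E0 & E = V @^-1` E0.
      apply: (sigma_of_sequence_preimage (g := fun i => h \o iter i V)) sE => [i|i w].
        exact: (measurableT_comp mh (measurable_iter_shift mV i)).
      by rewrite /= -iterS iterSr.
    have -> : eta @^-1` B = digits @^-1` A by [].
    by rewrite EE digV// (shift_preserving hVP).
  - by split=> //; exact: expectation_two_point.
rewrite /two_sided_tail le_max; apply/orP; left.
have m1 : 1 <= m%:R :> R by rewrite ler1n.
pose E0 := [set w | (`[Num.sqrt m.+1%:R, +oo[%classic : set T) (\sum_(i < m.+1) h (iter i V w))].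
have mray : measurable (`[Num.sqrt m.+1%:R, +oo[%classic : set T) by exact: measurable_itv.
have mE0 : measurable E0 by apply: (mpre _ _ (measurable_shift_sum mh mV m.+1) mray).
have mD : measurable [set u : T | digits u <= m%:R^-1] by exact: measurable_digits_le.
apply: (@le_trans _ _ (P ([set u : T | digits u <= m%:R^-1] `&` V @^-1` E0))).
  have -> : [set u : T | digits u <= m%:R^-1] = digits @^-1` `]-oo, m%:R^-1].
    by apply/seteqP; split=> u; rewrite /= in_itv.
  have mI : measurable (`]-oo, m%:R^-1]%classic : set T) by exact: measurable_itv.
  rewrite (digV _ _ mI mE0).
  have -> : digits @^-1` `]-oo, m%:R^-1] = [set u : T | digits u <= m%:R^-1].
    by apply/seteqP; split=> u; rewrite /= in_itv.
  rewrite [X in (X * _)%E]uniform_prob_digits_le; last first.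
    by rewrite invr_ge0 ler0n invf_le1 ?ltr0n.
  rewrite mulrC EFinM; apply: lee_wpmul2l; first by rewrite lee_fin invr_ge0.
  have n0 : 0 < Num.sqrt m.+1%:R :> R by rewrite sqrtr_gt0 ltr0n.
  apply: le_trans (normal_prob_tail_ge n0) _.
  by rewrite (normal_shift_sum_law mh mV hVP m mray).
apply: le_measure; rewrite ?inE.
- by apply: measurableI => //; exact: mpre.
- have -> : [set w | x <= random_sum P 2 xi eta w] = random_sum P 2 xi eta @^-1` `[x, +oo[.
    by apply/seteqP; split=> u; rewrite /= in_itv/= andbT.
  rewrite -[X in measurable X]setTI.
  by apply: measurable_random_sum => //; exact: measurable_itv.
(* On this event [eta] is m + 1, and the sum is at least the square root of m + 1, hence at least
   that of 2 x^2; dividing by the square root of A = 2 leaves at least x. *)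
- move=> w [/= wm]; rewrite /E0 /= in_itv/= andbT => wS.
  rewrite /random_sum /eta /= /two_point wm mulrC ler_pdivlMr ?sqrtr_gt0//.
  under eq_bigr do rewrite /= -iterS iterSr.
  apply: le_trans wS; apply: (le_trans (ler_norm _)).
  rewrite -sqrtr_sqr; apply: ler_wsqrtr.
  by rewrite exprMn sqr_sqrtr// mulrC.
Qed.

Theorem theorem3 (R : realType) :
  exists2 C : R, 0 < C &
    forall x : R, 3 <= x -> ((C * x ^- 2)%:E <= ereal_sup (tail_values x))%E.
Proof.
have c0 : 0 < normal_pdf 0 1 2%:R :> R.
  by rewrite normal_pdfE ?oner_neq0// mulr_gt0 ?normal_peak_gt0 ?oner_neq0// expR_gt0.
(* The example has tail at least the standard density at 2 divided by [m], and [m] is at most 2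
   x^2. *)
exists (normal_pdf 0 1 2%:R / 2); first by rewrite divr_gt0.
move=> x x3; have x18 : 18 <= 2 * x ^+ 2 by nra.
set m := Num.truncn (2 * x ^+ 2).
have /andP[mx xm] : m%:R <= 2 * x ^+ 2 < m.+1%:R by apply: truncn_itv; lra.
have m0 : (0 < m)%N by rewrite truncn_gt0; lra.
have [t tx ct] := two_point_tail_value m0 (ltW xm).
apply: le_trans (ereal_sup_ubound tx); apply: le_trans ct.
rewrite lee_fin -mulrA -invfM ler_wpM2l ?(ltW c0)//.
by rewrite lef_pV2 ?posrE ?ltr0n//; lra.
Qed.
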